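(* Let $d=\frac{p-1}2g^2$. If $p^m>2d$, then the analytic vector bundle $\mathcal L\to\mathfrak D^{(m),o}_{\mathrm{KZ}}$ is of rank $g$, i.e. $\dim_{\mathbb Q_p^{(m)}}\mathcal L_a=g$ for all $a\in\mathfrak D^{(m),o}_{\mathrm{KZ}}$.
   Context: Let $g\ge1$, $n=2g+1$, and let $p$ be a prime with $p>2g+1$; $z=(z_1,\dots,z_n)$. For $s\ge1$ let $\Phi_s(t,z)=\big((t-z_1)\cdots(t-z_n)\big)^{(p^s-1)/2}$, $F(t,z)=\Phi_1(t,z)$. Hasse–Witt matrices: $A(s,\Phi_s(t,z))$ is the $g\times g$ matrix whose $(u,v)$ entry ($u,v=1,\dots,g$) is the coefficient of $t^{p^sv-u}$ in $\Phi_s(t,z)$; its entries are in $\mathbb Z[z]$. The polynomial $\det A(1,F(t,z))$ is homogeneous of degree $d=\frac{p-1}2g^2$ in $z$. For $\ell=1,\dots,g$, let $I_{s,\ell}(z)=(I_{s,\ell,1},\dots,I_{s,\ell,n})$ be the column $n$-vector which is the coefficient of $t^{\ell p^s-1}$ in the column $n$-vector $\Big(\frac{\Phi_s(t,z)}{t-z_1},\dots,\frac{\Phi_s(t,z)}{t-z_n}\Big)$ of polynomials; $I_s(z)$ is the $n\times g$ matrix with columns $I_{s,1},\dots,I_{s,g}$. $\mathbb Q_p^{(m)}$ is the unramified extension of $\mathbb Q_p$ of degree $m$, with ring of integers $\mathbb Z_p^{(m)}$ and norm $|\cdot|_p$ extending that of $\mathbb Q_p$. Put $\mathfrak D^{(m)}_{\mathrm{KZ}}=\{a\in(\mathbb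 Z_p^{(m)})^n : |\det A(1,F(t,a))|_p=1\}$ and $\mathfrak D^{(m),o}_{\mathrm{KZ}}=\{a=(a_1,\dots,a_n)\in\mathfrak D^{(m)}_{\mathrm{KZ}} : a_i\ne a_j\ \text{for all } i\ne j\}$. It is a fact that the $n\times g$ matrices $I_s(z)\cdot A(s,\Phi_s(t,z))^{-1}$, whose entries are rational functions regular on $\mathfrak D^{(m)}_{\mathrm{KZ}}$, converge uniformly on $\mathfrak D^{(m)}_{\mathrm{KZ}}$ as $s\to\infty$ to an analytic $n\times g$ matrix, denoted $\mathcal I(z)$. Let $W=\{(I_1,\dots,I_n)\in(\mathbb Q_p^{(m)})^n : I_1+\dots+I_n=0\}$ (column vectors). For $a\in\mathfrak D^{(m)}_{\mathrm{KZ}}$ let $\mathcal L_a\subset W$ be the subspace spanned by the columns of $\mathcal I(a)$. The family $\mathcal L=\bigcup_a\mathcal L_a$ restricted to $\mathfrak D^{(m),o}_{\mathrm{KZ}}$ is the bundle $\mathcal L\to\mathfrak D^{(m),o}_{\mathrm{KZ}}$. *)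

(* Defs.v *)
From HB Require Import structures.
From mathcomp Require Import all_boot all_order all_algebra all_field.
From mathcomp Require Import classical_sets reals.

Set Implicit Arguments.
Unset Strict Implicit.
Unset Printing Implicit Defensive.

Import Order.TTheory GRing.Theory Num.Theory.
Local Open Scope ring_scope.
Local Open Scope classical_set_scope.

Section PadicFields.
Variable R : realType.

Record nonarch_abs (K : fieldType) (abs : K -> R) : Prop := NonarchAbs {
  nonarch_abs_ge0 : forall x, 0 <= abs x;
  nonarch_abs_eq0 : forall x, abs x = 0 <-> x = 0;
  nonarch_absM : forall x y, abs (x * y) = abs x * abs y;
  nonarch_absD : forall x y, abs (x + y) <= Num.max (abs x) (abs y) }.

Definition padic_abs (p : nat) (q : rat) : R :=
  if q == 0 then 0
  else p%:R ^ ((logn p `|denq q|)%:Z - (logn p `|numq q|)%:Z).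

Definition abs_cauchy (K : fieldType) (abs : K -> R) (u : nat -> K) : Prop :=
  forall e : R, 0 < e -> exists N : nat, forall i j : nat,
    (N <= i)%N -> (N <= j)%N -> abs (u i - u j) < e.

Definition abs_cvg (K : fieldType) (abs : K -> R) (u : nat -> K) (l : K) : Prop :=
  forall e : R, 0 < e -> exists N : nat, forall i : nat,
    (N <= i)%N -> abs (u i - l) < e.

(* [Qp], with [abs], is the completion of [rat] for the p-adic absolute value;
   this determines the pair up to a unique isomorphism.  The field
   [Qp_abs_rat] forces characteristic 0, so [ratr] is the embedding of [rat]. *)
Record is_Qp (p : nat) (Qp : fieldType) (abs : Qp -> R) : Prop := IsQp {
  Qp_abs : nonarch_abs abs;
  Qp_abs_rat : forall q : rat, abs (ratr q) = padic_abs p q;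
  Qp_rat_dense : forall (x : Qp) (e : R), 0 < e ->
    exists q : rat, abs (x - ratr q) < e;
  Qp_complete : forall u : nat -> Qp,
    abs_cauchy abs u -> exists l : Qp, abs_cvg abs u l }.

(* Unramified means ramification index 1: the value groups coincide. *)
Record is_unramified_ext (Qp : fieldType) (absQp : Qp -> R) (m : nat)
    (K : fieldExtType Qp) (absK : K -> R) : Prop := IsUnramifiedExt {
  unram_degree : \dim {:K} = m;
  unram_abs : nonarch_abs absK;
  unram_abs_ext : forall x : Qp, absK x%:A = absQp x;
  unram_value_group : forall x : K, x != 0 ->
    exists2 y : Qp, y != 0 & absK x = absQp y }.

End PadicFields.

(* The polynomials in [z] of the theory are given through their values at a
   point [a] : taking coefficients in [t] commutes with specialization of [z].
   Matrix and vector indices start at 0, hence the shifts [u.+1], [v.+1]. *)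
Section HasseWitt.
Variables (K : fieldType) (p g : nat).
Notation n := (2 * g).+1.

Definition master_poly (s : nat) (a : 'cV[K]_n) : {poly K} :=
  (\prod_(i < n) ('X - (a i 0)%:P)) ^+ ((p ^ s - 1) %/ 2).

Definition HasseWitt (s : nat) (a : 'cV[K]_n) : 'M[K]_g :=
  \matrix_(u < g, v < g) (master_poly s a)`_(p ^ s * v.+1 - u.+1).

Definition KZ_sol (s : nat) (a : 'cV[K]_n) : 'M[K]_(n, g) :=
  \matrix_(i < n, l < g)
    (master_poly s a %/ ('X - (a i 0)%:P))`_(l.+1 * p ^ s - 1).

Definition KZ_ratio (s : nat) (a : 'cV[K]_n) : 'M[K]_(n, g) :=
  KZ_sol s a *m invmx (HasseWitt s a).

Definition column_span (M : 'M[K]_(n, g)) : {vspace 'cV[K]_n} :=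
  <<[seq col l M | l <- enum 'I_g]>>%VS.

Variables (R : realType) (abs : K -> R).

Definition D_KZ : set 'cV[K]_n :=
  [set a : 'cV[K]_n | (forall i, abs (a i 0) <= 1) /\ abs (\det (HasseWitt 1 a)) = 1].

Definition D_KZ_o : set 'cV[K]_n :=
  [set a : 'cV[K]_n | D_KZ a /\ forall i j, i != j -> a i 0 != a j 0].

Definition uniform_limit_on (D : set 'cV[K]_n)
    (f : nat -> 'cV[K]_n -> 'M[K]_(n, g)) (F : 'cV[K]_n -> 'M[K]_(n, g)) : Prop :=
  forall e : R, 0 < e -> exists N : nat, forall s : nat, (N <= s)%N ->
    forall a, D a -> forall i l, abs (f s a i l - F a i l) < e.

End HasseWitt.

Definition degree_det_HW (p g : nat) : nat := ((p - 1) %/ 2 * g ^ 2)%N.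

(* Main.v *)
(** Write [P = prod_i (t - a_i)], [N = (p^s - 1)/2], and let [c] satisfy
    [Ical a *m c = 0].  For a polynomial [q], form the row vector of the
    coefficients of [t^(l p^s - 1)] in [P^(N-1) q] and multiply it by
    [A_s^-1 c]; let [V] be the space of those [q] for which the result tends to
    0 as [s] grows.  Then [V] contains every [P/(t - a_i)], hence, the [a_i]
    being distinct, all [q] of degree less than [n].  It also contains
    [2k t^(k-1) P - t^k P'] for [k > 0], because twice the derivative of
    [t^k P^N] is [P^(N-1)] times that polynomial modulo [p^s], while the
    coefficient of [t^(l p^s - 1)] in a derivative is divisible by [p^s].  The
    leading coefficient [2k - n] is nonzero as [n] is odd, so [V] contains all
    polynomials.  For [q = t^u P] the form equals the [u]-th entry of [c] for
    every [s > 0], hence [c = 0].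

    The estimates need [A_s^-1] to be integral: by Frobenius,
    [A_(s+1) = A_1 A_s^(p)] modulo [p], where [A_s^(p)] is the entrywise [p]-th
    power, so [det A_(s+1) = det A_1 (det A_s)^p] modulo [p] and all
    these determinants are units. *)

Require Import Defs.
From HB Require Import structures.
From mathcomp Require Import all_boot all_order all_algebra all_field.
From mathcomp Require Import classical_sets reals.
From mathcomp Require Import zify ring.

Set Implicit Arguments.
Unset Strict Implicit.
Unset Printing Implicit Defensive.

Import Order.TTheory GRing.Theory Num.Theory.
Local Open Scope ring_scope.

(** * Congruences modulo an integer, relative to a subring *)

(** The quotient [h] must lie in [S]: in a field where [p] is invertible the relation would
    otherwise hold between any two elements. *)
Definition eqmod_nat (A : nzRingType) (S : {pred A}) (p : nat) (x y : A) :=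
  exists2 h, h \in S & x = y + h *+ p.

Section CongruenceModNat.
Variables (A : comNzRingType) (S : subringClosed A) (p : nat).

Local Notation eqmod_nat := (eqmod_nat S p).

Lemma eqmod_nat_refl x : eqmod_nat x x.
Proof. by exists 0; rewrite ?rpred0 // mul0rn addr0. Qed.

Lemma eqmod_nat_trans x y z : eqmod_nat x y -> eqmod_nat y z -> eqmod_nat x z.
Proof.
move=> [h hS ->] [k kS ->]; exists (k + h); first exact: rpredD.
by rewrite mulrnDl addrA.
Qed.

Lemma eqmod_natD x y x' y' :
  eqmod_nat x y -> eqmod_nat x' y' -> eqmod_nat (x + x') (y + y').
Proof.
move=> [h hS ->] [k kS ->]; exists (h + k); first exact: rpredD.
by rewrite mulrnDl addrACA.
Qed.

Lemma eqmod_natM x y x' y' : y \in S -> y' \in S ->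
  eqmod_nat x y -> eqmod_nat x' y' -> eqmod_nat (x * x') (y * y').
Proof.
move=> yS y'S [h hS ->] [k kS ->].
exists (y * k + h * y' + h * k *+ p).
  by rewrite !rpredD ?rpredMn ?rpredM.
by ring.
Qed.

Lemma eqmod_nat_sum I (r : seq I) (P : pred I) (F G : I -> A) :
  (forall i, P i -> eqmod_nat (F i) (G i)) ->
  eqmod_nat (\sum_(i <- r | P i) F i) (\sum_(i <- r | P i) G i).
Proof.
move=> FG; elim/big_rec2: _ => [|i x y Pi xy]; first exact: eqmod_nat_refl.
by apply: eqmod_natD => //; apply: FG.
Qed.

Lemma eqmod_nat_prod I (r : seq I) (F G : I -> A) :
  (forall i, G i \in S) -> (forall i, eqmod_nat (F i) (G i)) ->
  eqmod_nat (\prod_(i <- r) F i) (\prod_(i <- r) G i).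
Proof.
move=> GS FG; elim: r => [|i r IH]; rewrite ?big_nil ?big_cons.
  exact: eqmod_nat_refl.
by apply: eqmod_natM => //; apply: rpred_prod.
Qed.

Lemma eqmod_nat_det n (M N : 'M[A]_n) :
  (forall i j, N i j \in S) -> (forall i j, eqmod_nat (M i j) (N i j)) ->
  eqmod_nat (\det M) (\det N).
Proof.
move=> NS MN; apply: eqmod_nat_sum => s _; apply: eqmod_natM.
- exact: rpred_sign.
- exact: rpred_prod.
- exact: eqmod_nat_refl.
- exact: eqmod_nat_prod.
Qed.

Hypothesis p_prime : prime p.

Lemma eqmod_nat_exprD x y : x \in S -> y \in S ->
  eqmod_nat ((x + y) ^+ p) (x ^+ p + y ^+ p).
Proof.
move=> xS yS.
(* The prime [p] divides every inner binomial coefficient, so these divisions are exact. *)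
exists (\sum_(i < p.-1) x ^+ (p - i.+1) * y ^+ i.+1 *+ ('C(p, i.+1) %/ p)).
  by apply: rpred_sum => i _; rewrite rpredMn // rpredM ?rpredX.
rewrite exprDn; have [q pq] : exists q, p = q.+1.
  by exists p.-1; rewrite prednK ?prime_gt0.
rewrite pq big_ord_recl big_ord_recr /= /bump !add1n subn0 subnn !expr0.
rewrite bin0 binn !mulr1n mulr1 mul1r.
rewrite [X in _ + X]addrC addrA; congr (_ + _).
rewrite -sumrMnl; apply: eq_bigr => i _.
by rewrite -mulrnA divnK // -pq prime_dvd_bin // pq /= ltnS ltn_ord.
Qed.

Lemma eqmod_nat_exp_sum I (r : seq I) (F : I -> A) :
  (forall i, F i \in S) ->
  eqmod_nat ((\sum_(i <- r) F i) ^+ p) (\sum_(i <- r) F i ^+ p).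
Proof.
move=> FS; elim: r => [|i r IH]; rewrite ?big_nil ?big_cons.
  by rewrite expr0n (negPf (lt0n_neq0 (prime_gt0 p_prime))); apply: eqmod_nat_refl.
apply: (eqmod_nat_trans (eqmod_nat_exprD _ _)) => //; first exact: rpred_sum.
by apply: eqmod_natD => //; apply: eqmod_nat_refl.
Qed.

(** Frobenius is additive modulo [p] on the Leibniz expansion, and an odd [p]-th power keeps the
    sign of each permutation. *)
Lemma eqmod_nat_exp_det n (M : 'M[A]_n) : odd p -> (forall i j, M i j \in S) ->
  eqmod_nat (\det M ^+ p) (\det (map_mx (fun x => x ^+ p) M)).
Proof.
move=> p_odd MS; apply: (eqmod_nat_trans (eqmod_nat_exp_sum _ _)).
  by move=> s; rewrite rpredM ?rpred_sign ?rpred_prod.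
apply: eqmod_nat_sum => s _; rewrite exprMn.
under [in X in eqmod_nat _ X]eq_bigr do rewrite mxE.
rewrite prodrXl.
rewrite -signr_odd -exprM -(signr_odd _ (_ * p)) oddM p_odd andbT.
by rewrite signr_odd; apply: eqmod_nat_refl.
Qed.

End CongruenceModNat.

(** * Frobenius on polynomials modulo [p] *)

Section PolynomialCongruence.
Variables (A : comNzRingType) (S : subringClosed A) (p : nat).

Lemma eqmod_nat_exp_poly (f : {poly A}) : prime p -> f \is a polyOver S ->
  eqmod_nat (polyOver_pred S) p (f ^+ p)
    (\sum_(j < size f) f`_j ^+ p *: 'X^(p * j)).
Proof.
move=> p_prime fS; rewrite -{1}[f]coefK poly_def.
apply: (eqmod_nat_trans (eqmod_nat_exp_sum p_prime _ _)).
  move=> i; rewrite -mul_polyC rpredM ?polyOverC ?rpredX ?polyOverX //.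
  exact: (polyOverP fS).
apply: eqmod_nat_sum => j _.
by rewrite exprZn -exprM mulnC; apply: eqmod_nat_refl.
Qed.

Lemma eqmod_nat_coef (f h : {poly A}) k :
  eqmod_nat (polyOver_pred S) p f h -> eqmod_nat S p f`_k h`_k.
Proof.
move=> [r rS ->]; exists r`_k; first exact: (polyOverP rS).
by rewrite coefD coefMn.
Qed.

End PolynomialCongruence.

(** * Arithmetic of the exponent [(p^s - 1) / 2] *)

Lemma odd_expn_half p s : odd p -> (((p ^ s - 1) %/ 2).*2.+1 = p ^ s)%N.
Proof.
move=> p_odd; have := odd_double_half (p ^ s); rewrite oddX p_odd orbT.
lia.
Qed.

Lemma half_expn_gt0 p s : (1 < p)%N -> odd p -> (0 < s)%N ->
  (0 < (p ^ s - 1) %/ 2)%N.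
Proof.
move=> p_gt1 p_odd s_gt0; have := odd_expn_half s p_odd.
by have := leq_pexp2l (ltnW p_gt1) s_gt0; rewrite expn1; lia.
Qed.

Lemma half_expnS p s : odd p ->
  ((p ^ s.+1 - 1) %/ 2 = (p ^ 1 - 1) %/ 2 + (p ^ s - 1) %/ 2 * p)%N.
Proof.
move=> p_odd.
have := odd_expn_half s.+1 p_odd; have := odd_expn_half s p_odd.
have := odd_expn_half 1 p_odd; rewrite (expnS p s) expn1.
move: ((p - 1) %/ 2)%N ((p ^ s - 1) %/ 2)%N ((p * p ^ s - 1) %/ 2)%N (p ^ s)%N.
nia.
Qed.

(** * Hasse-Witt matrices modulo [p] *)

Section HasseWittCongruence.
Variables (K : fieldType) (S : subringClosed K) (p g : nat).
Variable a : 'cV[K]_(2 * g).+1.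
Hypothesis a_int : forall i, a i 0 \in S.
Hypotheses (p_prime : prime p) (p_odd : odd p) (ltgp : (g < p)%N).

Lemma master_poly_over s : master_poly p s a \is a polyOver S.
Proof. by apply/rpredX/rpred_prod => i _; rewrite polyOverXsubC. Qed.

Lemma HasseWitt_over s u v : HasseWitt p s a u v \in S.
Proof. by rewrite mxE; apply: (polyOverP (master_poly_over s)). Qed.

Lemma size_master_poly_leq s :
  (size (master_poly p s a) <= ((2 * g).+1 * ((p ^ s - 1) %/ 2)).+1)%N.
Proof.
apply: (leq_trans (size_poly_exp_leq _ _)).
by rewrite -big_enum size_prod_XsubC size_enum_ord.
Qed.

Lemma coef_mul_sum_polyXn (f h : {poly K}) k :
  (f * \sum_(j < size h) h`_j ^+ p *: 'X^(p * j))`_k =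
  \sum_(j < size h) h`_j ^+ p * (if (k < p * j)%N then 0 else f`_(k - p * j)).
Proof.
rewrite mulr_sumr coef_sum; apply: eq_bigr => j _.
by rewrite -scalerAr coefZ coefMXn.
Qed.

(* [Phi_(s+1) = F * Phi_s ^+ p], and modulo p the factor [Phi_s ^+ p] only
   involves exponents divisible by p; the degree of [F] is what bounds the
   remaining range of summation by g. *)
Lemma HasseWittS s : (0 < s)%N ->
  forall u v, eqmod_nat S p (HasseWitt p s.+1 a u v)
    ((HasseWitt p 1 a *m map_mx (fun x => x ^+ p) (HasseWitt p s a)) u v).
Proof.
move=> s_gt0 u v; rewrite !mxE.
have -> : master_poly p s.+1 a = master_poly p 1 a * master_poly p s a ^+ p.
  by rewrite /master_poly half_expnS // exprD exprM.
have szF := size_master_poly_leq 1.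
move: (master_poly_over s) (master_poly_over 1).
under eq_bigr do rewrite !mxE.
move: (master_poly p s a) (master_poly p 1 a) szF => f F szF fS FS.
have /eqmod_nat_coef : eqmod_nat (polyOver_pred S) p (F * f ^+ p)
    (F * \sum_(j < size f) f`_j ^+ p *: 'X^(p * j)).
  apply: eqmod_natM => //; last exact: eqmod_nat_exp_poly.
    apply: rpred_sum => j _.
    apply: (polyOverZ (S := S)); last exact/rpredX/polyOverX.
    exact/rpredX/(polyOverP fS).
  exact: eqmod_nat_refl.
move/(_ (p ^ s.+1 * v.+1 - u.+1)%N); set c := (X in eqmod_nat _ _ _ X -> _).
suff -> : c = \sum_(w < g)
  F`_(p ^ 1 * w.+1 - u.+1) * f`_(p ^ s * v.+1 - w.+1) ^+ p by [].
rewrite {}/c coef_mul_sum_polyXn (expnS p s) expn1 -mulnA.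
(* Ensures that no subtraction [q - w.+1] with [w < g] is truncated. *)
have : (g <= p ^ s * v.+1)%N.
  have := leq_pexp2l (prime_gt0 p_prime) s_gt0; rewrite expn1 mulnS; lia.
move: (p ^ s * v.+1)%N => q ltgq.
(* Reindex by [j = q - w.+1]: only the exponents [j] with [q - g <= j < q] contribute. *)
transitivity (\sum_(w < g) \sum_(j < size f | (j + w.+1 == q)%N)
    f`_j ^+ p *
      (if (p * q - u.+1 < p * j)%N then 0 else F`_(p * q - u.+1 - p * j))).
  rewrite (exchange_big_dep xpredT) //=; apply: eq_bigr => j _.
  have [|jq] := boolP ((j < q) && (q <= j + g))%N.
    move=> jq; have ltw : (q - j.+1 < g)%N by lia.
    rewrite (big_pred1 (Ordinal ltw)) // => w.
    rewrite /= -val_eqE /=; lia.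
  rewrite big_pred0; last by move=> w; have := ltn_ord w; lia.
  case: ifP => // qj; first by rewrite mulr0.
  (* Here [j + g < q], so the index is at least [p (g + 1) - g], beyond the degree bound
     [(2 g + 1) (p - 1) / 2] of [F]. *)
  rewrite [F`__]nth_default ?mulr0 //.
  apply: (leq_trans szF).
  have := odd_expn_half 1 p_odd; rewrite expn1.
  have := ltn_ord u.
  nia.
apply: eq_bigr => w _.
have ltwg := ltn_ord w; have ltug := ltn_ord u.
have [ltf|lef] := ltnP (q - w.+1) (size f).
  rewrite (big_pred1 (Ordinal ltf)) => [|j]; last by rewrite /= -val_eqE /=; lia.
  rewrite /= mulrC ifF; last by nia.
  by congr (F`_ _ * _); nia.
rewrite (nth_default _ lef) big_pred0; last by move=> j; have := ltn_ord j; lia.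
by rewrite expr0n (negPf (lt0n_neq0 (prime_gt0 p_prime))) mulr0.
Qed.

Lemma det_HasseWittS s : (0 < s)%N ->
  eqmod_nat S p (\det (HasseWitt p s.+1 a))
    (\det (HasseWitt p 1 a) * \det (HasseWitt p s a) ^+ p).
Proof.
move=> s_gt0.
have frobS i j : map_mx (fun x => x ^+ p) (HasseWitt p s a) i j \in S.
  by rewrite mxE rpredX ?HasseWitt_over.
have [h hS Eh] : eqmod_nat S p (\det (HasseWitt p s.+1 a))
    (\det (HasseWitt p 1 a *m map_mx (fun x => x ^+ p) (HasseWitt p s a))).
  apply: eqmod_nat_det; last exact: HasseWittS.
  move=> i j; rewrite mxE rpred_sum // => k _.
  by rewrite rpredM ?HasseWitt_over.
have [k kS Ek] := eqmod_nat_exp_det p_prime p_odd (HasseWitt_over s).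
(* By [Ek], replacing the determinant of the Frobenius twist by [\det (HasseWitt p s a) ^+ p] costs
   [k *+ p], multiplied by the first determinant. *)
exists (h - \det (HasseWitt p 1 a) * k).
  rewrite rpredB // rpredM // rpred_sum // => t _.
  by rewrite rpredM ?rpred_sign // rpred_prod // => i _; apply: HasseWitt_over.
by rewrite Eh det_mulmx Ek; ring.
Qed.

End HasseWittCongruence.

(** * Ultrametric absolute values, integers and limits *)

Section NonarchimedeanAbs.
Variables (R : realType) (K : fieldType) (abs : K -> R).
Hypothesis absP : nonarch_abs abs.

Let abs_ge0 := nonarch_abs_ge0 absP.
Let absM := nonarch_absM absP.

Lemma nonarch_abs0 : abs 0 = 0.
Proof. exact/(nonarch_abs_eq0 absP). Qed.

Lemma nonarch_abs1 : abs 1 = 1.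
Proof.
have abs1_neq0 : abs 1 != 0.
  by apply/eqP => /(nonarch_abs_eq0 absP)/eqP; rewrite oner_eq0.
by apply: (mulfI abs1_neq0); rewrite -absM !mulr1.
Qed.

Lemma nonarch_absX x n : abs (x ^+ n) = abs x ^+ n.
Proof. by elim: n => [|n IH]; rewrite ?nonarch_abs1 // !exprS absM IH. Qed.

Lemma nonarch_absN x : abs (- x) = abs x.
Proof.
rewrite -mulN1r absM; suff -> : abs (- 1) = 1 by rewrite mul1r.
apply/eqP; rewrite -(@eqrXn2 _ 2) ?abs_ge0 ?ler01 //.
by rewrite -nonarch_absX sqrrN !expr1n nonarch_abs1.
Qed.

Lemma nonarch_absD_le x y e : abs x <= e -> abs y <= e -> abs (x + y) <= e.
Proof.
by move=> xe ye; apply: le_trans (nonarch_absD absP x y) _; rewrite ge_max xe ye.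
Qed.

Lemma nonarch_absD_lt x y e : abs x < e -> abs y < e -> abs (x + y) < e.
Proof.
move=> xe ye; apply: le_lt_trans (nonarch_absD absP x y) _.
by rewrite gt_max xe ye.
Qed.

(* The argument [absP] only serves to make the subring structure inferable. *)
Definition nonarch_int of nonarch_abs abs : {pred K} :=
  [pred x | abs x <= 1].

Lemma nonarch_intE x : (x \in nonarch_int absP) = (abs x <= 1).
Proof. by []. Qed.

Fact nonarch_int_subring_closed : subring_closed (nonarch_int absP).
Proof.
split=> [|x y|x y]; rewrite !nonarch_intE.
- by rewrite nonarch_abs1.
- by move=> xi yi; apply: nonarch_absD_le; rewrite ?nonarch_absN.
- by move=> xi yi; rewrite absM mulr_ile1 ?abs_ge0.
Qed.

HB.instance Definition _ := GRing.isSubringClosed.Build K (nonarch_int absP)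
  nonarch_int_subring_closed.

(** A unit stays a unit under a perturbation from the maximal ideal; this carries unit determinants
    through congruences modulo [p]. *)
Lemma nonarch_abs_eq1 x y : abs y = 1 -> abs (x - y) < 1 -> abs x = 1.
Proof.
move=> y1 xy1; apply/eqP; rewrite eq_le -{2}y1.
have -> : abs x <= 1.
  rewrite -[x](subrK y); apply: nonarch_absD_le; rewrite ?y1 //; exact: ltW.
rewrite leNgt; apply/negP => xy; have : abs y < 1; last by rewrite y1 ltxx.
rewrite y1 in xy.
have -> : y = - (x - y) + x by ring.
by apply: nonarch_absD_lt; rewrite ?nonarch_absN.
Qed.

Lemma abs_cvgD u v x y : abs_cvg abs u x -> abs_cvg abs v y ->
  abs_cvg abs (fun s => u s + v s) (x + y).
Proof.
move=> ux vy e e_gt0; have [M uM] := ux e e_gt0; have [N vN] := vy e e_gt0.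
exists (maxn M N) => s; rewrite geq_max => /andP[Ms Ns].
rewrite opprD addrACA; apply: nonarch_absD_lt; [exact: uM|exact: vN].
Qed.

Lemma abs_cvgZ c u x : abs_cvg abs u x -> abs_cvg abs (fun s => c * u s) (c * x).
Proof.
move=> ux e e_gt0; have [->|c_neq0] := eqVneq c 0.
  by exists 0%N => s _; rewrite !mul0r subrr nonarch_abs0.
have c_gt0 : 0 < abs c.
  rewrite lt_def abs_ge0 andbT; apply/eqP => /(nonarch_abs_eq0 absP)/eqP.
  exact/negP.
have [N uN] := ux _ (divr_gt0 e_gt0 c_gt0).
exists N => s Ns; rewrite -mulrBr absM mulrC -ltr_pdivlMr //; exact: uN.
Qed.

Lemma abs_cvg_sum I (r : seq I) (u : I -> nat -> K) (x : I -> K) :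
  (forall i, abs_cvg abs (u i) (x i)) ->
  abs_cvg abs (fun s => \sum_(i <- r) u i s) (\sum_(i <- r) x i).
Proof.
move=> ux; elim: r => [|i r IH] e e_gt0.
  by exists 0%N => s _; rewrite !big_nil subrr nonarch_abs0.
have [N uN] := abs_cvgD (ux i) IH e_gt0.
by exists N => s Ns; rewrite !big_cons; apply: uN.
Qed.

Lemma eventually_eq_abs_cvg u x y N :
  abs_cvg abs u x -> (forall s, (N <= s)%N -> u s = y) -> x = y.
Proof.
move=> ux uy; apply/eqP; rewrite -subr_eq0; apply/eqP/(nonarch_abs_eq0 absP).
apply/eqP; rewrite eq_le abs_ge0 andbT leNgt; apply/negP => xy_gt0.
have [M uM] := ux _ xy_gt0.
have := uM (maxn M N) (leq_maxl _ _); rewrite uy ?leq_maxr //.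
by rewrite -opprB nonarch_absN ltxx.
Qed.

End NonarchimedeanAbs.

(** * The [p]-adic absolute value on an unramified extension *)

Section PadicAbs.
Variables (R : realType) (p : nat) (p_prime : prime p).

Lemma padic_abs_nat : padic_abs R p p%:R = p%:R^-1.
Proof.
rewrite /padic_abs pnatr_eq0 (negPf (lt0n_neq0 (prime_gt0 p_prime))).
by rewrite (numq_int p) (denq_int p) /= logn1 -{3}[p]expn1 pfactorK.
Qed.

Lemma padic_abs_neq0 q : q != 0 -> padic_abs R p q != 0.
Proof.
move=> q_neq0; rewrite /padic_abs (negPf q_neq0) expfz_neq0 //.
by rewrite pnatr_eq0 lt0n_neq0 ?prime_gt0.
Qed.

Variables (Qp : fieldType) (absQp : Qp -> R) (m : nat).
Variables (K : fieldExtType Qp) (absK : K -> R).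
Hypotheses (hQp : is_Qp p absQp) (hK : is_unramified_ext absQp m absK).

Lemma unramified_abs_natr n : absK n%:R = padic_abs R p n%:R.
Proof.
have -> : (n%:R : K) = (n%:R)%:A by rewrite scaler_nat.
by rewrite (unram_abs_ext hK) -(ratr_nat Qp) (Qp_abs_rat hQp).
Qed.

Lemma unramified_abs_p : absK p%:R = p%:R^-1.
Proof. by rewrite unramified_abs_natr padic_abs_nat. Qed.

(** Characteristic zero, read off from the absolute value; it will make the leading coefficients
    [2k - n] invertible. *)
Lemma unramified_natr_neq0 n : (0 < n)%N -> (n%:R : K) != 0.
Proof.
move=> n_gt0; apply/eqP => /(nonarch_abs_eq0 (unram_abs hK))/eqP.
by rewrite unramified_abs_natr (negPf (padic_abs_neq0 _)) ?pnatr_eq0 ?lt0n_neq0.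
Qed.

Lemma abs_cvg_expr_p : abs_cvg absK (fun s => (p%:R : K) ^+ s) 0.
Proof.
(* For [s] past this bound, [e^-1 < s < p^s]. *)
move=> e e_gt0; exists (Num.bound e^-1) => s Ns.
rewrite subr0 (nonarch_absX (unram_abs hK)) unramified_abs_p exprVn.
rewrite -[ltRHS]invrK ltf_pV2 ?posrE ?invr_gt0 ?exprn_gt0 ?ltr0n ?prime_gt0 //.
apply: lt_le_trans (archi_boundP _) _; first by rewrite invr_ge0 ltW.
rewrite -natrX ler_nat (leq_trans Ns) // ltnW // ltn_expl // prime_gt1 //.
Qed.
End PadicAbs.

(** * Integrality of determinants and adjugates *)

Section RpredMatrix.
Variables (A : comNzRingType) (S : subringClosed A).

Lemma rpred_det n (M : 'M[A]_n) : (forall i j, M i j \in S) -> \det M \in S.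
Proof.
by move=> MS; apply: rpred_sum => s _; rewrite rpredM ?rpred_sign ?rpred_prod.
Qed.

Lemma rpred_adj n (M : 'M[A]_n) i j :
  (forall i j, M i j \in S) -> \adj M i j \in S.
Proof.
move=> MS; rewrite mxE rpredM ?rpred_sign // rpred_det // => k l.
by rewrite !mxE.
Qed.

End RpredMatrix.

(** * Polynomials with prescribed roots, and a spanning family *)

Section RootPolynomials.
Variables (K : fieldType) (n : nat) (a : 'cV[K]_n).

Definition roots_poly : {poly K} := \prod_(i < n) ('X - (a i 0)%:P).

Definition roots_poly_but (i : 'I_n) : {poly K} :=
  \prod_(j < n | j != i) ('X - (a j 0)%:P).

Lemma roots_polyE i : roots_poly = roots_poly_but i * ('X - (a i 0)%:P).
Proof. by rewrite /roots_poly (bigD1 i) //= mulrC. Qed.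

Lemma monic_roots_poly : roots_poly \is monic.
Proof. exact: monic_prod_XsubC. Qed.

Lemma size_roots_poly : size roots_poly = n.+1.
Proof. by rewrite /roots_poly -big_enum size_prod_XsubC size_enum_ord. Qed.

Lemma size_roots_poly_but i : size (roots_poly_but i) = n.
Proof.
have := size_roots_poly; rewrite (roots_polyE i) mulrC.
rewrite size_monicM ?monicXsubC ?size_XsubC ?monic_neq0 ?monic_prod_XsubC //.
by case.
Qed.

(** Lagrange interpolation: the difference of the two sides has degree less than [n] and vanishes at
    [n] distinct points. *)
Lemma lagrange_roots_poly (q : {poly K}) :
  (forall i j, i != j -> a i 0 != a j 0) -> (size q <= n)%N ->
  q = \sum_(i < n) (q.[a i 0] / (roots_poly_but i).[a i 0]) *: roots_poly_but i.
Proof.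
move=> a_inj szq; set r := \sum_(i < n) _; apply/eqP; rewrite -subr_eq0.
apply: contraT => qr_neq0.
have := max_poly_roots qr_neq0 (rs := [seq a i 0 | i <- enum 'I_n]).
rewrite size_map size_enum_ord ltnNge.
have -> : (size (q - r)%R <= n)%N.
  rewrite (leq_trans (size_polyD _ _)) // geq_max szq size_polyN.
  apply: (leq_trans (size_sum _ _ _)); apply/bigmax_leqP => i _.
  by rewrite (leq_trans (size_scale_leq _ _)) // size_roots_poly_but.
move=> rootsP; apply: rootsP => //; last first.
  rewrite map_inj_uniq ?enum_uniq // => i j; apply: contra_eq; exact: a_inj.
apply/allP => _ /mapP[i _ ->]; rewrite /root hornerD hornerN horner_sum.
rewrite (bigD1 i) //= big1 => [|j ji].
  rewrite hornerZ divfK ?addr0 ?subrr //.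
  rewrite horner_prod; apply/prodf_neq0 => j ji.
  by rewrite hornerXsubC subr_eq0 a_inj // eq_sym.
rewrite hornerZ [X in _ * X](_ : _ = 0) ?mulr0 //.
rewrite /roots_poly_but (bigD1 i) 1?eq_sym //=.
by rewrite hornerM hornerXsubC subrr mul0r.
Qed.

(* Twice the cofactor of [roots_poly ^+ (N - 1)] in the derivative of
   ['X^k * roots_poly ^+ N], at the limiting exponent [N = - 1/2]. *)
Definition twisted_deriv (k : nat) : {poly K} :=
  roots_poly * 'X^(k.-1) *+ (2 * k) - roots_poly^`() * 'X^k.

Lemma coef_twisted_deriv k j : (0 < k)%N -> (k.-1 + n <= j)%N ->
  (twisted_deriv k)`_j = if j == (k.-1 + n)%N then (2 * k)%:R - n%:R else 0.
Proof.
move=> k_gt0 lej; rewrite coefB coefMn !coefMXn coef_deriv.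
rewrite [(j < k.-1)%N]ltnNge [(j < k)%N]ltnNge (_ : k.-1 <= j)%N /=; last by lia.
case: eqP => [->|jn]; last first.
  rewrite !nth_default ?size_roots_poly ?mul0rn ?subr0 //; last by lia.
    by case: ifP; rewrite ?mul0rn ?subrr //.
  lia.
have := monic_roots_poly; rewrite monicE lead_coefE size_roots_poly /= => /eqP Pn.
(* The first branch forces [n = 0], where the subtracted [n%:R] vanishes too. *)
rewrite addKn Pn; case: ifP => [ltk|lek].
  by rewrite (_ : n = 0)%N //; lia.
by rewrite (_ : (k.-1 + n - k).+1 = n)%N ?Pn //; lia.
Qed.

(** With [M + 1 = (p^s - 1) / 2], the last multiplier is [p^s], which makes the product a derivative
    modulo [p^s]. *)
Lemma exp_twisted_deriv M k : (0 < k)%N ->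
  roots_poly ^+ M * twisted_deriv k =
  (roots_poly ^+ M.+1 * 'X^k)^`() *+ 2
    - roots_poly ^+ M * roots_poly^`() * 'X^k *+ (M.+1).*2.+1.
Proof.
case: k => // k _; rewrite /twisted_deriv derivM deriv_exp derivXn /=.
by rewrite -muln2 !exprS; move: roots_poly^`() => P'; ring.
Qed.

(** Induction on the size of [q]: Lagrange interpolation settles degrees below [n], and above that a
    multiple of some [twisted_deriv] cancels the leading term. *)
Lemma poly_span_ind (V : {poly K} -> Prop) :
  (forall i j, i != j -> a i 0 != a j 0) ->
  (forall k, (0 < k)%N -> (2 * k)%:R != n%:R :> K) ->
  (forall q r, V q -> V r -> V (q + r)) ->
  (forall c q, V q -> V (c *: q)) ->
  (forall i, V (roots_poly_but i)) ->
  (forall k, (0 < k)%N -> V (twisted_deriv k)) ->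
  forall q, V q.
Proof.
move=> a_inj neq VD VZ Vroots Vderiv q.
have V0 : V 0 by rewrite -(scale0r (twisted_deriv 1)); apply/VZ/Vderiv.
have [m] := ubnP (size q); elim: m q => // m IH q; rewrite ltnS => szq.
have [len|ltn] := leqP (size q) n.
  rewrite (lagrange_roots_poly a_inj len); elim/big_ind: _ => // i _; exact: VZ.
have [k k_gt0 szE] : exists2 k, (0 < k)%N & (size q = k + n)%N.
  by exists (size q - n)%N; rewrite ?subn_gt0 // subnK // ltnW.
set e : K := (2 * k)%:R - n%:R; have e_neq0 : e != 0 by rewrite subr_eq0 neq.
rewrite -(subrK ((lead_coef q / e) *: twisted_deriv k) q).
apply: VD; last exact/VZ/Vderiv.
apply: IH; apply: leq_trans szq; rewrite -[ltnRHS]prednK ?ltnS; last by lia.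
apply/leq_sizeP => j lej; rewrite coefB coefZ coef_twisted_deriv //; last by lia.
case: eqP => [->|jn].
  rewrite divfK // lead_coefE (_ : (size q).-1 = k.-1 + n)%N ?subrr //; lia.
by rewrite mulr0 subr0 nth_default // szE; move: jn lej; rewrite szE; lia.
Qed.

End RootPolynomials.

(** * The residue form and its values on the spanning family *)

Section ResidueForm.
Variables (R : realType) (K : fieldType) (abs : K -> R) (p g : nat).
Hypotheses (absP : nonarch_abs abs) (abs_p_lt1 : abs p%:R < 1).
Hypotheses (p_prime : prime p) (p_odd : odd p) (ltgp : (g < p)%N).
Variable a : 'cV[K]_(2 * g).+1.
Hypothesis aD : D_KZ p abs a.

Local Notation int := (nonarch_int absP).
Local Notation N s := ((p ^ s - 1) %/ 2)%N.
Local Notation P := (roots_poly a).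

Lemma abs_det_HasseWitt s : (0 < s)%N -> abs (\det (HasseWitt p s a)) = 1.
Proof.
have [a_int det1] := aD.
elim: s => // s IH _; case: s IH => [//|s] /(_ isT) IH.
have [h h_int ->] : eqmod_nat int p (\det (HasseWitt p s.+2 a))
    (\det (HasseWitt p 1 a) * \det (HasseWitt p s.+1 a) ^+ p).
  exact: det_HasseWittS.
set y := _ * _; apply: (nonarch_abs_eq1 absP (y := y)).
  by rewrite (nonarch_absM absP) (nonarch_absX absP) det1 IH expr1n mulr1.
rewrite addrC addKr -mulr_natr (nonarch_absM absP).
by apply: le_lt_trans abs_p_lt1; rewrite ler_piMl ?(nonarch_abs_ge0 absP).
Qed.

Lemma HasseWitt_unit s : (0 < s)%N -> HasseWitt p s a \in unitmx.
Proof.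
move=> s_gt0; rewrite unitmxE unitfE; apply/eqP => det0.
have := abs_det_HasseWitt s_gt0; rewrite det0 (nonarch_abs0 absP) => /eqP.
by rewrite eq_sym oner_eq0.
Qed.

(** The inverse is the adjugate divided by a determinant of absolute value 1. *)
Lemma invmx_HasseWitt_int s u v : (0 < s)%N -> invmx (HasseWitt p s a) u v \in int.
Proof.
move=> s_gt0; rewrite /invmx HasseWitt_unit // mxE rpredM //.
  rewrite nonarch_intE -[leLHS]mul1r -{1}(abs_det_HasseWitt s_gt0).
  rewrite -(nonarch_absM absP) mulfV ?(nonarch_abs1 absP) //.
  by have := HasseWitt_unit s_gt0; rewrite unitmxE unitfE.
apply: rpred_adj => i j; apply: HasseWitt_over; exact: aD.1.
Qed.

(** The rows of both matrices are values of this one linear map: [P / (t - a_i)] gives row [i] of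
    [KZ_sol], and [t^u P] gives row [u] of [HasseWitt]. *)
Definition residue_vec s (q : {poly K}) : 'rV[K]_g :=
  \row_l (P ^+ (N s).-1 * q)`_(l.+1 * p ^ s - 1).

Definition residue_form (c : 'cV[K]_g) s q : K :=
  (residue_vec s q *m invmx (HasseWitt p s a) *m c) 0 0.

Lemma residue_formD c s q r :
  residue_form c s (q + r) = residue_form c s q + residue_form c s r.
Proof.
rewrite /residue_form.
rewrite (_ : residue_vec s (q + r) = residue_vec s q + residue_vec s r).
  by rewrite !mulmxDl mxE.
by apply/rowP => l; rewrite !mxE mulrDr coefD.
Qed.

Lemma residue_formZ c s b q : residue_form c s (b *: q) = b * residue_form c s q.
Proof.
rewrite /residue_form (_ : residue_vec s (b *: q) = b *: residue_vec s q).
  by rewrite -!scalemxAl mxE.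
by apply/rowP => l; rewrite !mxE -scalerAr coefZ.
Qed.

Lemma residue_form_monomial c s (u : 'I_g) : (0 < s)%N ->
  residue_form c s (P * 'X^u) = c u 0.
Proof.
move=> s_gt0.
have -> : c u 0 = (row u (1%:M *m c)) 0 0 by rewrite mul1mx mxE.
rewrite -(mulmxV (HasseWitt_unit s_gt0)) -mulmxA row_mul mulmxA.
congr ((_ *m _ *m _) _ _); apply/rowP => l; rewrite !mxE mulrA -exprSr.
rewrite prednK ?half_expn_gt0 ?prime_gt1 // coefMXn.
(* Since [u < g < p <= p^s], the shift by [t^u] stays within range and yields the index
   [p^s (l + 1) - (u + 1)]. *)
have := ltn_ord u; have := leq_pexp2l (prime_gt0 p_prime) s_gt0; rewrite expn1.
move=> leps ltug; rewrite ifF; last by nia.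
by rewrite [(p ^ s * _)%N]mulnC -subnDA [(1 + _)%N]add1n.
Qed.

Lemma residue_form_roots_poly_but c s i : (0 < s)%N ->
  residue_form c s (roots_poly_but a i) = (KZ_ratio p s a *m c) i 0.
Proof.
move=> s_gt0; have -> : (KZ_ratio p s a *m c) i 0 =
    (row i (KZ_sol p s a) *m invmx (HasseWitt p s a) *m c) 0 0.
  by rewrite -!row_mul [RHS]mxE.
congr ((_ *m _ *m _) _ _); apply/rowP => l; rewrite !mxE; congr (_`_ _).
have N_gt0 := half_expn_gt0 (prime_gt1 p_prime) p_odd s_gt0.
rewrite /master_poly -/(roots_poly a) -(prednK N_gt0) exprSr /=.
by rewrite [X in _ * X %/ _](roots_polyE a i) mulrA mulpK // polyXsubC_eq0.
Qed.

(** Differentiation multiplies the coefficient of [t^(l p^s)] by [l p^s], and the correction term of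
    [exp_twisted_deriv] also carries [p^s]. *)
Lemma residue_vec_twisted_deriv s k : (0 < s)%N -> (0 < k)%N ->
  exists2 h : 'rV[K]_g, forall l, h 0 l \in int &
    residue_vec s (twisted_deriv a k) = p%:R ^+ s *: h.
Proof.
move=> s_gt0 k_gt0; have Ps : P \is a polyOver int.
  by apply/rpred_prod => i _; rewrite polyOverXsubC; apply: aD.1.
pose F := P ^+ N s * 'X^k; pose G := P ^+ (N s).-1 * P^`() * 'X^k.
have Fs : F \is a polyOver int by rewrite rpredM ?rpredX ?polyOverX.
have Gs : G \is a polyOver int.
  by rewrite !rpredM ?rpredX ?polyOverX ?polyOver_deriv.
have E : P ^+ (N s).-1 * twisted_deriv a k = F^`() *+ 2 - G *+ p ^ s.
  by rewrite exp_twisted_deriv // prednK ?half_expn_gt0 ?prime_gt1 ?odd_expn_half.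
exists (\row_l (F`_(l.+1 * p ^ s) *+ l.+1 *+ 2 - G`_(l.+1 * p ^ s - 1))).
  move=> l; rewrite mxE rpredB ?rpredMn //; first exact: (polyOverP Fs).
  exact: (polyOverP Gs).
apply/rowP => l; rewrite !mxE E coefB !coefMn coef_deriv.
have -> : (l.+1 * p ^ s - 1).+1 = (l.+1 * p ^ s)%N.
  by rewrite subn1 prednK // muln_gt0 /= expn_gt0 (prime_gt0 p_prime).
rewrite -natrX mulr_natl mulrnBl; congr (_ - _).
by rewrite -!mulrnA -[in LHS]mulnA [(_ * 2)%N in LHS]mulnC.
Qed.

(** Each entry before pairing with [c] is [p^s] times an integer. As [c] may be non-integral but is
    fixed, its entries enter afterwards as constant scalars. *)
Lemma residue_form_twisted_deriv_cvg c k :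
  abs_cvg abs (fun s => p%:R ^+ s) 0 -> (0 < k)%N ->
  abs_cvg abs (fun s => residue_form c s (twisted_deriv a k)) 0.
Proof.
move=> p_cvg k_gt0.
have form_sum s : residue_form c s (twisted_deriv a k) =
    \sum_l c l 0 *
      (residue_vec s (twisted_deriv a k) *m invmx (HasseWitt p s a)) 0 l.
  by rewrite /residue_form mxE; apply: eq_bigr => l _; rewrite mulrC.
have entry_cvg l : abs_cvg abs (fun s =>
    (residue_vec s (twisted_deriv a k) *m invmx (HasseWitt p s a)) 0 l) 0.
  move=> e /p_cvg[M pM]; exists M.+1 => s Ms.
  have s_gt0 : (0 < s)%N by case: s Ms.
  have [h h_int ->] := residue_vec_twisted_deriv s_gt0 k_gt0.
  apply: le_lt_trans (pM s (ltnW Ms)).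
  rewrite !subr0 -scalemxAl mxE (nonarch_absM absP).
  rewrite ler_piMr ?(nonarch_abs_ge0 absP) // -(nonarch_intE absP).
  by rewrite mxE rpred_sum // => j _; rewrite rpredM ?invmx_HasseWitt_int.
have := abs_cvg_sum absP (index_enum _)
  (fun l => abs_cvgZ absP (c l 0) (entry_cvg l)).
rewrite big1 => [|l _]; last by rewrite mulr0.
by move=> cvg e /cvg[M cvgM]; exists M => s; rewrite form_sum; apply: cvgM.
Qed.

End ResidueForm.

(** * From injectivity to rank, and the conclusion *)

Lemma dim_column_span (K : fieldType) g (M : 'M[K]_((2 * g).+1, g)) :
  (forall c : 'cV[K]_g, M *m c = 0 -> c = 0) -> \dim (column_span M) = g.
Proof.
move=> M_inj.
suff /eqP-> : free [seq col l M | l <- enum 'I_g] by rewrite size_map size_enum_ord.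
have -> : [seq col l M | l <- enum 'I_g] = [tuple col l M | l < g] by [].
apply/freeP => c c0 l.
suff /colP/(_ l) : \col_l c l = 0 by rewrite !mxE.
apply: M_inj; rewrite -c0; apply/colP => i; rewrite mxE summxE.
by apply: eq_bigr => j _; rewrite -tnth_nth tnth_mktuple !mxE mulrC.
Qed.

Theorem theorem6p9 (R : realType) (g p m : nat)
  (Qp : fieldType) (absQp : Qp -> R)
  (K : fieldExtType Qp) (absK : K -> R)
  (Ical : 'cV[K]_(2 * g).+1 -> 'M[K]_((2 * g).+1, g))
  (hg : (1 <= g)%N) (hp : prime p) (hpg : (2 * g + 1 < p)%N)
  (hQp : is_Qp p absQp)
  (hK : is_unramified_ext absQp m absK)
  (hI : uniform_limit_on absK (D_KZ p absK) (@KZ_ratio K p g) Ical)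
  (hm : (2 * degree_det_HW p g < p ^ m)%N) :
  forall a : 'cV[K]_(2 * g).+1, D_KZ_o p absK a ->
    \dim (column_span (Ical a)) = g.
Proof.
move=> a [aD a_inj]; apply: dim_column_span => c Ic0.
have absP := unram_abs hK.
have p_odd : odd p by case: (even_prime hp) => // p2; lia.
have ltgp : (g < p)%N by lia.
have abs_p_lt1 : absK p%:R < 1.
  rewrite (unramified_abs_p hp hQp hK) invf_lt1 ?ltr1n ?prime_gt1 //.
  by rewrite ltr0n prime_gt0.
have all_null q : abs_cvg absK (fun s => residue_form p a c s q) 0.
  move: q; apply: (poly_span_ind a_inj).
  (* By parity [2k] differs from [2g + 1]; the two orders are separated because the difference is
     taken in [nat]. *)
  - move=> k _; rewrite -subr_eq0; have [le|lt] := leqP (2 * k) (2 * g).+1.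
      rewrite -opprB oppr_eq0 -natrB // (unramified_natr_neq0 hp hQp hK) //; lia.
    by rewrite -natrB ?(ltnW lt) // (unramified_natr_neq0 hp hQp hK) // subn_gt0.
  - move=> q r qV rV e e_gt0; have [M cvgM] := abs_cvgD absP qV rV e_gt0.
    by exists M => s Ms; rewrite residue_formD -(addr0 0); apply: cvgM.
  - move=> b q qV e e_gt0; have [M cvgM] := abs_cvgZ absP b qV e_gt0.
    by exists M => s Ms; rewrite residue_formZ -(mulr0 b); apply: cvgM.
  - move=> i.
    have ratio_cvg l : abs_cvg absK (fun s => KZ_ratio p s a i l) (Ical a i l).
      by move=> e /hI[M hM]; exists M => s Ms; apply: hM.
    have := abs_cvg_sum absP (index_enum _)
      (fun l => abs_cvgZ absP (c l 0) (ratio_cvg l)).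
    (* The limit is entry [i] of [Ical a *m c], zero by assumption. *)
    rewrite (_ : \sum_l _ = 0); last first.
      have /colP/(_ i) := Ic0; rewrite !mxE => {2}<-.
      by apply: eq_bigr => l _; rewrite mulrC.
    move=> cvg e /cvg[M cvgM]; exists M.+1 => s Ms.
    rewrite residue_form_roots_poly_but //; last by case: s Ms.
    rewrite mxE; under eq_bigr do rewrite mulrC.
    exact: cvgM (ltnW Ms).
  - move=> k k_gt0; apply: (residue_form_twisted_deriv_cvg absP) => //.
    exact (abs_cvg_expr_p hp hQp hK).
apply/colP => u; rewrite mxE; symmetry.
(* On [t^u P] the form is constantly [c u 0] from [s = 1] on, yet it tends to 0. *)
apply: (eventually_eq_abs_cvg absP (all_null (roots_poly a * 'X^u)) (N := 1)).
by move=> s s_gt0; apply: (residue_form_monomial absP).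
Qed.
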